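(* Let $\mathcal{G}=\langle\mathcal{H},\mathcal{E}\rangle$ be a quantum Markov chain. Then $\mathcal{E}_\infty(\mathcal{H})$ can be decomposed into the direct sum of some (pairwise) orthogonal bottom strongly connected components (BSCCs) of $\mathcal{G}$.
   Context: $\mathcal{H}$ is a (nonzero) finite-dimensional complex Hilbert space. A density operator is a positive semidefinite operator of trace $1$; a pure state is a unit vector $|\psi\rangle$, and $\psi=|\psi\rangle\langle\psi|$. $\mathrm{supp}(\rho)$ is the span of the eigenvectors of $\rho$ with nonzero eigenvalue. $\bigvee$ denotes the span of a union of subspaces, $P_X$ the orthogonal projection onto $X$. A quantum Markov chain is a pair $\langle\mathcal{H},\mathcal{E}\rangle$ with $\mathcal{E}$ a trace-preserving completely positive linear map on the operators on $\mathcal{H}$. For a completely positive map $\mathcal{F}$ and a subspace $X$, the image is $\mathcal{F}(X)=\bigvee_{|\psi\rangle\in X}\mathrm{supp}(\mathcal{F}(\psi))$. $X$ is invariant if $\mathcal{E}(X)\subseteq X$. For a chain $\langle\mathcal{K},\mathcal{F}\rangle$ ($\mathcal{F}$ completely positive and trace-nonincreasing on $\mathcal{K}$), a path is a sequence of density operators $\rho_0\to\cdots\to\rho_n$, $n\ge 0$, with $\mathrm{supp}(\rho_{i+1})\subseteq\mathcal{F}(\mathrm{supp}(\rho_i))$. For a pure state $|\psi\rangle$, $\mathcal{R}_{\langle\mathcal{K},\mathcal{F}\rangle}(\psi)$ is the span of all pure states $|\varphi\rangle$ such that there is a path from $\psi$ to $\varphi$; equivalently $\bigvee_{i\ge 0}\mathrm{supp}(\mathcal{F}^i(\psi))$.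 The restriction to $X$ is $\mathcal{G}_X=\langle X,\mathcal{E}|_X\rangle$ with $\mathcal{E}|_X(\rho)=P_X\mathcal{E}(\rho)P_X$. $X$ is strongly connected if $|\varphi\rangle\in\mathcal{R}_{\mathcal{G}_X}(\psi)$ and $|\psi\rangle\in\mathcal{R}_{\mathcal{G}_X}(\varphi)$ for all pure states $|\varphi\rangle,|\psi\rangle\in X$. An SCC is a $\subseteq$-maximal strongly connected subspace; a BSCC is an invariant SCC. The asymptotic average of $\mathcal{E}$ is $\mathcal{E}_\infty=\lim_{N\to\infty}\frac1N\sum_{n=1}^N\mathcal{E}^n$ (the limit exists and is again a trace-preserving completely positive map). *)

(* Defs.v *)
From HB Require Import structures.
From mathcomp Require Import all_boot all_order all_algebra.
From mathcomp Require Import complex.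
From mathcomp Require Import boolp classical_sets reals topology normedtype.
From mathcomp Require Import sequences.

Set Implicit Arguments.
Unset Strict Implicit.
Unset Printing Implicit Defensive.

Import Order.TTheory GRing.Theory Num.Theory.
Import numFieldNormedType.Exports.
Local Open Scope classical_set_scope.
Local Open Scope ring_scope.
Local Open Scope sesquilinear_scope.

(* The Hilbert space of dimension n is C^n with the inner product [dotmx].
   As everywhere in mxalgebra, vectors are rows, an operator [A] acts by
   [v |-> v *m A], and a subspace is (the row space of) a square matrix, to be
   compared only through the relations of [matrix_set_scope]. *)

(* The ascription makes the topology of [numClosedFieldType]s, the one given by
   the modulus, available on [R[i]]. *)
Definition cplx (R : realType) : numClosedFieldType := R[i].

Section HilbertSpace.
Variables (C : numClosedFieldType).

Definition is_span n (S : set 'rV[C]_n) (V : 'M[C]_n) : Prop :=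
  (forall v, S v -> (v <= V)%MS) /\
  (forall W : 'M[C]_n, (forall v, S v -> (v <= W)%MS) -> (V <= W)%MS).

Definition spanmx n (S : set 'rV[C]_n) : 'M[C]_n := get (is_span S).

Lemma spanmxP n (S : set 'rV[C]_n) : is_span S (spanmx S).
Proof.
apply: (@getPex _ (is_span S)).
pose P k := `[< exists2 V : 'M[C]_n, \rank V = k
                & forall v, S v -> (v <= V)%MS >].
have exP : exists k, P k.
  exists (\rank (1%:M : 'M[C]_n)); apply/asboolP; exists 1%:M => // v _.
  exact: submx1.
case: (ex_minnP exP) => k /asboolP [V rV SV] kmin.
exists V; split=> // W SW.
have VW : (V :&: W <= V)%MS by apply: capmxSl.
have rk : (\rank V <= \rank (V :&: W)%MS)%N.
  rewrite rV; apply: kmin; apply/asboolP; exists (V :&: W)%MS => // v Sv.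
  by rewrite sub_capmx SV ?SW.
have := mxrank_leqif_sup VW => /leqifP; case: ifP => [VVW _|_].
  exact: submx_trans VVW (capmxSr _ _).
by rewrite ltnNge rk.
Qed.

Definition orthogonal_spaces n (X Y : 'M[C]_n) : Prop :=
  forall u v : 'rV[C]_n, (u <= X)%MS -> (v <= Y)%MS -> dotmx u v = 0.

Definition pure n (psi : 'rV[C]_n) : Prop := dotmx psi psi = 1.

Definition ketbra n (psi : 'rV[C]_n) : 'M[C]_n := psi^t* *m psi.

(* The order of C makes [0 <= z] contain that z is real, so positive
   semidefinite operators are in particular Hermitian. *)
Definition psd n (A : 'M[C]_n) : Prop :=
  forall u : 'rV[C]_n, 0 <= dotmx (u *m A) u.

Definition density n (rho : 'M[C]_n) : Prop := psd rho /\ \tr rho = 1.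

Definition supp n (rho : 'M[C]_n) : 'M[C]_n :=
  spanmx [set v | v != 0 /\ exists2 a : C, a != 0 & v *m rho = a *: v].

(* Operators on C^k (x) C^n are k x k block matrices with n x n blocks, on
   which id (x) E acts blockwise. *)
Definition completely_positive n (E : 'M[C]_n -> 'M[C]_n) : Prop :=
  forall (k : nat) (A : 'I_k -> 'I_k -> 'M[C]_n),
    psd (\mxblock_(i < k, j < k) A i j) ->
    psd (\mxblock_(i < k, j < k) E (A i j)).

Definition trace_preserving n (E : 'M[C]_n -> 'M[C]_n) : Prop :=
  forall A, \tr (E A) = \tr A.

Definition quantum_markov_chain n (E : {linear 'M[C]_n -> 'M[C]_n}) : Prop :=
  completely_positive E /\ trace_preserving E.

Definition channel_image n (F : 'M[C]_n -> 'M[C]_n) (X : 'M[C]_n) : 'M[C]_n :=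
  spanmx [set w | exists psi : 'rV[C]_n,
            [/\ pure psi, (psi <= X)%MS & (w <= supp (F (ketbra psi)))%MS]].

Definition invariant_space n (E : 'M[C]_n -> 'M[C]_n) (X : 'M[C]_n) : Prop :=
  (channel_image E X <= X)%MS.

(* A chain <K, F> on a subspace K of C^n is given by K and F, the operators on
   K being identified with the operators on C^n supported in K. *)
Definition chain_path n (K : 'M[C]_n) (F : 'M[C]_n -> 'M[C]_n)
    (rho : 'M[C]_n) (s : seq 'M[C]_n) : Prop :=
  (forall sigma, sigma \in rho :: s -> density sigma /\ (supp sigma <= K)%MS) /\
  path (fun sigma tau => (supp tau <= channel_image F (supp sigma))%MS) rho s.

Definition reach n (K : 'M[C]_n) (F : 'M[C]_n -> 'M[C]_n)
    (psi : 'rV[C]_n) : 'M[C]_n :=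
  spanmx [set phi | pure phi /\ exists2 s : seq 'M[C]_n,
            chain_path K F (ketbra psi) s & last (ketbra psi) s = ketbra phi].

Definition channel_restriction n (E : 'M[C]_n -> 'M[C]_n) (X : 'M[C]_n) :
    'M[C]_n -> 'M[C]_n :=
  fun rho => proj_ortho X *m E rho *m proj_ortho X.

Definition strongly_connected n (E : 'M[C]_n -> 'M[C]_n) (X : 'M[C]_n) : Prop :=
  forall phi psi : 'rV[C]_n,
    pure phi -> pure psi -> (phi <= X)%MS -> (psi <= X)%MS ->
    (phi <= reach X (channel_restriction E X) psi)%MS /\
    (psi <= reach X (channel_restriction E X) phi)%MS.

Definition SCC n (E : 'M[C]_n -> 'M[C]_n) (X : 'M[C]_n) : Prop :=
  strongly_connected E X /\
  (forall Y : 'M[C]_n, strongly_connected E Y -> (X <= Y)%MS -> (Y <= X)%MS).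

Definition BSCC n (E : 'M[C]_n -> 'M[C]_n) (X : 'M[C]_n) : Prop :=
  SCC E X /\ invariant_space E X.

(* The limit is taken pointwise, which on the finite-dimensional space of
   superoperators is the same as in norm. *)
Definition asymptotic_average n (E : 'M[C]_n -> 'M[C]_n) : 'M[C]_n -> 'M[C]_n :=
  fun A => lim ((fun N : nat =>
    (N.+1)%:R^-1 *: \sum_(1 <= k < N.+2) iter k E A) @ \oo).

End HilbertSpace.

(* Main.v *)
(* For a subspace Y, the vectors v with supp E(|v><v|) <= Y form the kernel of
   the dual image of the projector onto Y^perp, hence a subspace.  So spaces of
   reachable states are invariant, and the minimal nonzero invariant subspaces
   are BSCCs.

   Orbits of E are bounded, so the mean ergodic theorem splits the operators as
   ker(1 - E) + im(1 - E), and E_oo is the projection onto the first summand.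
   The image of E_oo is the support of the stationary operator
   sigma = E_oo(1), hence invariant.  The orthocomplement, within supp sigma,
   of an invariant X <= supp sigma is again invariant, because sigma is
   stationary and faithful on its support; so minimal invariant subspaces can
   be split off one after the other. *)
Require Import Defs.
From mathcomp Require Import all_boot all_order all_algebra.
From mathcomp Require Import complex.
From mathcomp Require Import boolp classical_sets reals topology normedtype.
From mathcomp Require Import sequences ring.

Set Implicit Arguments.
Unset Strict Implicit.
Unset Printing Implicit Defensive.

Import Order.TTheory GRing.Theory Num.Theory.
Import numFieldNormedType.Exports.
Local Open Scope ring_scope.
Local Open Scope sesquilinear_scope.

(** * Adjoints, traces and positive semidefinite matrices *)

Section Positive.
Variable C : numClosedFieldType.

Lemma adjmxM m n p (A : 'M[C]_(m, n)) (B : 'M[C]_(n, p)) :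
  (A *m B)^t* = B^t* *m A^t*.
Proof. by rewrite trmx_mul map_mxM. Qed.

Lemma adjmxD m n (A B : 'M[C]_(m, n)) : (A + B)^t* = A^t* + B^t*.
Proof. by rewrite linearD /= map_mxD. Qed.

Lemma adjmxB m n (A B : 'M[C]_(m, n)) : (A - B)^t* = A^t* - B^t*.
Proof. by rewrite linearB /= map_mxB. Qed.

Lemma adjmxZ m n (a : C) (A : 'M[C]_(m, n)) : (a *: A)^t* = a^* *: A^t*.
Proof. by rewrite linearZ /= map_mxZ. Qed.

Lemma adjmx1 n : (1%:M : 'M[C]_n)^t* = 1%:M.
Proof. by rewrite trmx1 map_mx1. Qed.

Lemma mxtrace_mul_adj m n (A : 'M[C]_(m, n)) :
  \tr (A *m A^t*) = \sum_i \sum_j `|A i j| ^+ 2.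
Proof.
apply: eq_bigr => i _; rewrite mxE; apply: eq_bigr => j _.
by rewrite !mxE normCK.
Qed.

Lemma mxtrace_mul_adj_ge0 m n (A : 'M[C]_(m, n)) : 0 <= \tr (A *m A^t*).
Proof.
by rewrite mxtrace_mul_adj; do 2!apply: sumr_ge0 => ? _; exact: exprn_ge0.
Qed.

Lemma mxtrace_mul_adj_eq0 m n (A : 'M[C]_(m, n)) :
  \tr (A *m A^t*) = 0 -> A = 0.
Proof.
rewrite mxtrace_mul_adj => /eqP.
rewrite psumr_eq0 => [|i _]; last by apply: sumr_ge0 => ? _; exact: exprn_ge0.
move=> /allP A0; apply/matrixP => i j; rewrite mxE.
have := A0 i (mem_index_enum i); rewrite psumr_eq0 => [|? _]; last exact: exprn_ge0.
by move=> /allP/(_ j (mem_index_enum j)); rewrite sqrf_eq0 normr_eq0 => /eqP.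
Qed.

Lemma dotmx_trE n (u v : 'rV[C]_n) : dotmx u v = \tr (u *m v^t*).
Proof. by rewrite dotmxE /mxtrace big_ord1. Qed.

Lemma dotmx_ketbra n (u : 'rV[C]_n) (A : 'M[C]_n) :
  dotmx (u *m A) u = \tr (ketbra u *m A).
Proof. by rewrite dotmx_trE -mulmxA mxtrace_mulC -mulmxA mxtrace_mulC. Qed.

Lemma mxtrace_ketbra n (u : 'rV[C]_n) : \tr (ketbra u) = dotmx u u.
Proof. by rewrite dotmx_trE mxtrace_mulC. Qed.

Lemma psd_mul_adj m n (B : 'M[C]_(m, n)) : psd (B^t* *m B).
Proof.
move=> u; rewrite dotmx_trE mulmxA -mulmxA.
have -> : B *m u^t* = (u *m B^t*)^t* by rewrite adjmxM trmxCK.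
exact: mxtrace_mul_adj_ge0.
Qed.

Lemma psd_ketbra n (u : 'rV[C]_n) : psd (ketbra u).
Proof. exact: psd_mul_adj. Qed.

Lemma psdD n (A B : 'M[C]_n) : psd A -> psd B -> psd (A + B).
Proof.
move=> pA pB u; have := addr_ge0 (pA u) (pB u).
by rewrite !dotmx_trE mulmxDr mulmxDl mxtraceD.
Qed.

Lemma psdZ n (a : C) (A : 'M[C]_n) : 0 <= a -> psd A -> psd (a *: A).
Proof.
move=> a0 pA u; have := pA u.
by rewrite !dotmx_trE -scalemxAr -scalemxAl mxtraceZ; exact: mulr_ge0.
Qed.

Lemma psd_conj m n (A : 'M[C]_n) (B : 'M[C]_(m, n)) :
  psd A -> psd (B *m A *m B^t*).
Proof.
move=> pA u; have := pA (u *m B); rewrite !dotmx_trE !mulmxA.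
by rewrite adjmxM mulmxA.
Qed.

(** Polarisation: the form at [u + a *: v] relates [q u v] to [q v u], and the two relations for [a]
    equal to 1 and ['i] force both to vanish. *)
Lemma quadratic_form_eq0 n (A : 'M[C]_n) :
  (forall u : 'rV_n, \tr (u *m A *m u^t*) = 0) -> A = 0.
Proof.
move=> A0; pose q (u v : 'rV[C]_n) := \tr (u *m A *m v^t*).
have qD (a : C) u v : a^* * q u v + a * q v u = 0.
  have := A0 (u + a *: v); rewrite adjmxD adjmxZ !mulmxDl !mulmxDr.
  rewrite -!scalemxAl -!scalemxAr -/(q _ _) !mxtraceD !mxtraceZ.
  by rewrite !A0 !mulr0 add0r addr0.
have q0 u v : q u v = 0.
  have := qD 1 u v; rewrite conjC1 !mul1r => /eqP; rewrite addr_eq0 => /eqP quv.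
  have := qD 'i u v; rewrite conjCi quv mulrNN -mulrDl -mulr2n => /eqP.
  by rewrite mulf_eq0 mulrn_eq0 /= (negPf (neq0Ci _)) /= => /eqP ->; rewrite oppr0.
apply/matrixP => i j; rewrite mxE; have := q0 (delta_mx 0 i) (delta_mx 0 j).
rewrite /q -rowE trmx_delta map_delta_mx -colE /mxtrace big_ord1 => <-.
by rewrite !mxE.
Qed.

(** The quadratic form of [A] is real, so that of [A - A^t*] vanishes identically. *)
Lemma psd_herm n (A : 'M[C]_n) : psd A -> A^t* = A.
Proof.
move=> pA; apply/eqP; rewrite eq_sym -subr_eq0; apply/eqP.
apply: quadratic_form_eq0 => u.
rewrite mulmxBr mulmxBl linearB /=; apply/eqP; rewrite subr_eq0; apply/eqP.
have -> : u *m A^t* *m u^t* = (u *m A *m u^t*)^t*.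
  by rewrite !adjmxM trmxCK mulmxA.
rewrite trace_map_mx mxtrace_tr /= -dotmx_trE.
by apply/esym/CrealP/ger0_real/pA.
Qed.

(** Each eigenvalue is the value of the form at a row of the diagonalising unitary, hence
    nonnegative and with a nonnegative square root. *)
Lemma psd_factor n (A : 'M[C]_n) : psd A -> exists B : 'M[C]_n, A = B^t* *m B.
Proof.
move=> pA; have Aherm : A \is hermsymmx.
  by apply/is_hermitianmxP; rewrite expr0 scale1r psd_herm.
have /orthomx_spectralP eA := hermitian_normalmx Aherm.
move: eA (spectral_unitarymx A) => /=.
move: (spectralmx A) (spectral_diag A) => P d eA uP.
rewrite (invmx_unitary uP) in eA.
have d0 i : 0 <= d 0 i.
  have e1 : row i P *m P^t* = delta_mx 0 i.
    by rewrite -row_mul (unitarymxP uP) row1.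
  have e2 : P *m (row i P)^t* = delta_mx i 0.
    by rewrite -[RHS]trmxCK trmx_delta map_delta_mx -e1 adjmxM trmxCK.
  have := pA (row i P); rewrite dotmx_trE eA !mulmxA e1 -mulmxA e2.
  rewrite -rowE row_diag_mx -scalemxAl mxtraceZ mul_delta_mx.
  by rewrite /mxtrace big_ord1 mxE !eqxx mulr1.
exists (diag_mx (\row_i sqrtC (d 0 i)) *m P).
rewrite adjmxM tr_diag_mx map_diag_mx mulmxA -(mulmxA (P^t*)) mulmx_diag {1}eA.
congr (_ *m diag_mx _ *m _); apply/rowP => i; rewrite !mxE.
have /geC0_conj e : 0 <= sqrtC (d 0 i) by rewrite sqrtC_ge0.
by rewrite [X in X * _]e -expr2 sqrtCK.
Qed.

(** After factoring both operators, the trace is the squared Hilbert-Schmidt norm of [F *m D^t*]. *)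
Lemma psd_mxtrace_ge0 n (A B : 'M[C]_n) : psd A -> psd B -> 0 <= \tr (A *m B).
Proof.
move=> /psd_factor[D ->] /psd_factor[F ->].
rewrite mulmxA mxtrace_mulC !mulmxA -(mulmxA (F *m _)).
have -> : D *m F^t* = (F *m D^t*)^t* by rewrite adjmxM trmxCK.
exact: mxtrace_mul_adj_ge0.
Qed.

(** The same norm is now zero, so the middle factor [D *m F^t*] of the product vanishes. *)
Lemma psd_mxtrace_eq0 n (A B : 'M[C]_n) :
  psd A -> psd B -> \tr (A *m B) = 0 -> A *m B = 0.
Proof.
move=> /psd_factor[D ->] /psd_factor[F ->].
rewrite mulmxA mxtrace_mulC !mulmxA -(mulmxA (F *m _)) -(mulmxA (D^t*)).
have eDF : D *m F^t* = (F *m D^t*)^t* by rewrite adjmxM trmxCK.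
rewrite eDF => /mxtrace_mul_adj_eq0 ->.
by rewrite trmx0 map_mx0 mulmx0 mul0mx.
Qed.

Lemma psd_ker n (A : 'M[C]_n) (u : 'rV_n) :
  psd A -> dotmx (u *m A) u = 0 -> u *m A = 0.
Proof.
move=> /psd_factor[B ->]; rewrite dotmx_trE mulmxA -mulmxA.
have -> : B *m u^t* = (u *m B^t*)^t* by rewrite adjmxM trmxCK.
by move=> /mxtrace_mul_adj_eq0 ->; rewrite mul0mx.
Qed.

(** In a spectral decomposition the rows of the diagonal matrix times [P] are eigenvectors scaled by
    their eigenvalues. Supports can thus be handled as row spaces. *)
Lemma psd_supp n (A : 'M[C]_n) : psd A -> (supp A :=: A)%MS.
Proof.
move=> pA; have Aherm : A \is hermsymmx.
  by apply/is_hermitianmxP; rewrite expr0 scale1r psd_herm.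
have [suppS suppmin] := spanmxP [set v : 'rV[C]_n | v != 0 /\
  exists2 a : C, a != 0 & v *m A = a *: v].
apply/eqmxP/andP; split.
  apply: suppmin => v [_ [a a0 vA]].
  by rewrite -[v]scale1r -(mulVf a0) -scalerA -vA scalemx_sub ?submxMl.
have /orthomx_spectralP eA := hermitian_normalmx Aherm.
move: eA (spectral_unitarymx A) => /=.
move: (spectralmx A) (spectral_diag A) => P d eA uP.
have Pu := unitarymx_unit uP.
rewrite {1}eA -mulmxA mulmx_sub //; apply/row_subP => i.
rewrite row_mul row_diag_mx -scalemxAl -rowE; have [->|di] := eqVneq (d 0 i) 0.
  by rewrite scale0r sub0mx.
apply: scalemx_sub; apply: suppS; split.
  apply/negP => /eqP rP; have := congr1 (mulmx^~ (invmx P)) rP.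
  rewrite /= -row_mul mulmxV // mul0mx row1 => /rowP/(_ i)/eqP.
  by rewrite !mxE !eqxx oner_eq0.
exists (d 0 i) => //; rewrite eA !mulmxA -row_mul mulmxV // row1.
by rewrite -rowE row_diag_mx -scalemxAl -rowE.
Qed.

Lemma ketbra_sub n m (u : 'rV[C]_n) (X : 'M[C]_(m, n)) :
  (ketbra u <= X)%MS = (u <= X)%MS.
Proof.
apply/idP/idP => [|uX]; last by rewrite mulmx_sub.
move=> uX; have [->|u0] := eqVneq u 0; first exact: sub0mx.
have uu : dotmx u u != 0 by rewrite dnorm_eq0.
rewrite -[u]scale1r -(mulVf uu) -scalerA scalemx_sub //.
have -> : dotmx u u *: u = u *m ketbra u.
  by rewrite mulmxA [u *m _]mx11_scalar -dotmxE mul_scalar_mx.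
by rewrite mulmx_sub.
Qed.

(** * Orthogonal projectors and orthocomplements *)

Section Projector.
Variables (n : nat) (X : 'M[C]_n).
Let P : 'M[C]_n := proj_ortho X.

(** Orthogonality of [1%:M - P] to [X] gives [P^t* = P *m P^t*], whose right-hand side is
    Hermitian. *)
Lemma proj_ortho_adj : P^t* = P.
Proof.
have /orthomx1P PXo := proj_ortho_compl_sub X 1%:M.
have /submxP[D eP] : (P <= X)%MS by rewrite proj_orthoE.
have : (1%:M - P) *m P^t* = 0.
  by rewrite eP adjmxM mulmxA -eP -{1}[P]mul1mx PXo mul0mx.
rewrite mulmxBl mul1mx => /eqP; rewrite subr_eq0 => /eqP PP.
have PPh : (P *m P^t*)^t* = P *m P^t* by rewrite adjmxM trmxCK.
by rewrite PP -PPh -PP trmxCK.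
Qed.

Lemma psd_proj_ortho : psd P.
Proof.
have <- : P^t* *m P = P by rewrite proj_ortho_adj; exact: proj_ortho_proj.
exact: psd_mul_adj.
Qed.

Lemma psd_proj_ortho_compl : psd (1%:M - P).
Proof.
have <- : (1%:M - P)^t* *m (1%:M - P) = 1%:M - P.
  rewrite adjmxB adjmx1 proj_ortho_adj mulmxBl mul1mx mulmxBr mulmx1.
  by rewrite [P *m P]proj_ortho_proj subrr subr0.
exact: psd_mul_adj.
Qed.

Lemma sub_proj_orthoP m (A : 'M[C]_(m, n)) :
  reflect (A *m P = A) (A <= X)%MS.
Proof.
apply: (iffP idP) => [|<-]; first exact: proj_ortho_id.
exact: proj_ortho_sub.
Qed.

End Projector.

Definition ocomp n (X : 'M[C]_n) : 'M[C]_n := 1%:M - proj_ortho X.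

Lemma ocompP n m (X : 'M[C]_n) (A : 'M[C]_(m, n)) :
  reflect (A *m proj_ortho X = 0) (A <= ocomp X)%MS.
Proof.
apply: (iffP idP) => [/submxP[D ->]|AP].
  by rewrite -mulmxA mulmxBl mul1mx proj_ortho_proj subrr mulmx0.
by rewrite -[A](subr0) -AP -{1}[A]mulmx1 -mulmxBr submxMl.
Qed.

Lemma orthogonal_ocomp n (X : 'M[C]_n) : orthogonal_spaces X (ocomp X).
Proof.
move=> u v /sub_proj_orthoP <- /ocompP vP.
rewrite dotmx_trE -mulmxA -(proj_ortho_adj X) -adjmxM vP.
by rewrite trmx0 map_mx0 mulmx0 mxtrace0.
Qed.

Lemma orthogonal_spacesS n (X Y X' Y' : 'M[C]_n) :
  (X' <= X)%MS -> (Y' <= Y)%MS -> orthogonal_spaces X Y -> orthogonal_spaces X' Y'.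
Proof.
by move=> X'X Y'Y XY u v uX vY; apply: XY; apply: submx_trans; eauto.
Qed.

Lemma orthogonal_spaces_sym n (X Y : 'M[C]_n) :
  orthogonal_spaces X Y -> orthogonal_spaces Y X.
Proof.
move=> XY u v uY vX; have := XY v u vX uY; rewrite !dotmxE => vu0.
apply/eqP; rewrite -conjC_eq0 -vu0; apply/eqP.
rewrite !mxE rmorph_sum; apply: eq_bigr => i _.
by rewrite !mxE rmorphM /= conjCK mulrC.
Qed.

Lemma normalize_pure n (v : 'rV[C]_n) : v != 0 ->
  exists a (u : 'rV[C]_n), [/\ a != 0, pure u & v = a *: u].
Proof.
move=> v0; have vv : 0 < dotmx v v by rewrite dnorm_gt0.
pose c := sqrtC (dotmx v v); have c0 : 0 < c by rewrite sqrtC_gt0.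
exists c, (c^-1 *: v); split; rewrite ?gt_eqF //; last first.
  by rewrite scalerA divff ?gt_eqF // scale1r.
rewrite /pure dotmx_trE adjmxZ -scalemxAl -scalemxAr !mxtraceZ -dotmx_trE.
have /geC0_conj -> : 0 <= c^-1 by rewrite invr_ge0 ltW.
by rewrite mulrA -invfM -expr2 sqrtCK mulVf // gt_eqF.
Qed.

Lemma ketbraZ n (a : C) (v : 'rV[C]_n) : ketbra (a *: v) = (`|a| ^+ 2) *: ketbra v.
Proof. by rewrite /ketbra adjmxZ -scalemxAl -scalemxAr scalerA normCK mulrC. Qed.

End Positive.

(** * Positive maps, their duals and invariant subspaces *)

Definition positive (C : numClosedFieldType) n (E : 'M[C]_n -> 'M[C]_n) :=
  forall A, psd A -> psd (E A).

Section PositiveMap.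
Variables (C : numClosedFieldType) (n : nat).
Variable E : {linear 'M[C]_n -> 'M[C]_n}.
Hypothesis Epos : positive E.

(* The image of the observable P under the Heisenberg dual of E. *)
Definition dualmx (P : 'M[C]_n) : 'M[C]_n :=
  \matrix_(i, j) \tr (E (delta_mx j i) *m P).

Lemma mxtrace_dualmx A P : \tr (A *m dualmx P) = \tr (E A *m P).
Proof.
rewrite {2}[A]matrix_sum_delta linear_sum mulmx_suml linear_sum /=.
apply: eq_bigr => i _; rewrite linear_sum mulmx_suml linear_sum mxE /=.
by apply: eq_bigr => j _; rewrite linearZ -scalemxAl mxtraceZ mxE.
Qed.

Lemma psd_dualmx P : psd P -> psd (dualmx P).
Proof.
move=> pP u; rewrite dotmx_ketbra mxtrace_dualmx.
exact/psd_mxtrace_ge0/pP/Epos/psd_ketbra.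
Qed.

(** Both sides say that [E (ketbra v)] has trace 0 against the projector on [X]: for positive
    operators a zero trace means a zero product, and a zero of a positive form lies in its kernel.
    The condition thus becomes linear in [v]. *)
Lemma positive_sub_ocomp (v : 'rV[C]_n) (X : 'M[C]_n) :
  (E (ketbra v) <= ocomp X)%MS <-> v *m dualmx (proj_ortho X) = 0.
Proof.
have pE := Epos (psd_ketbra v); have pX := psd_proj_ortho X.
split=> [/ocompP EX|vX].
  by apply: psd_ker; rewrite ?dotmx_ketbra ?mxtrace_dualmx ?EX ?mxtrace0 //;
    exact: psd_dualmx.
apply/ocompP/psd_mxtrace_eq0 => //.
by rewrite -mxtrace_dualmx -dotmx_ketbra vX linear0l.
Qed.

Lemma positive_sub (v : 'rV[C]_n) (X : 'M[C]_n) :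
  (E (ketbra v) <= X)%MS <-> v *m dualmx (1%:M - proj_ortho X) = 0.
Proof.
have pE := Epos (psd_ketbra v); have pX := psd_proj_ortho_compl X.
split=> [/sub_proj_orthoP EX|vX].
  apply: psd_ker; first exact: psd_dualmx.
  by rewrite dotmx_ketbra mxtrace_dualmx mulmxBr mulmx1 EX subrr mxtrace0.
have := psd_mxtrace_eq0 pE pX.
rewrite -mxtrace_dualmx -dotmx_ketbra vX linear0l => /(_ erefl) /eqP.
rewrite mulmxBr mulmx1 subr_eq0 => /eqP EX.
exact/sub_proj_orthoP/esym.
Qed.

Lemma channel_image_sub (F : 'M[C]_n -> 'M[C]_n) (X Y : 'M[C]_n) :
  positive F ->
  (forall v : 'rV_n, pure v -> (v <= X)%MS -> (F (ketbra v) <= Y)%MS) ->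
  (channel_image F X <= Y)%MS.
Proof.
move=> Fpos FXY; rewrite /channel_image; set S := (X in spanmx X).
apply: (proj2 (spanmxP S)) => w [v [pv vX wF]].
apply: submx_trans wF _; rewrite psd_supp; first exact: FXY.
exact/Fpos/psd_ketbra.
Qed.

Lemma sub_channel_image (F : 'M[C]_n -> 'M[C]_n) (X : 'M[C]_n) (v : 'rV_n) :
  positive F -> pure v -> (v <= X)%MS -> (F (ketbra v) <= channel_image F X)%MS.
Proof.
move=> Fpos pv vX; rewrite /channel_image; set S := (X in spanmx X).
apply/row_subP => i; apply: (proj1 (spanmxP S)).
exists v; split=> //; rewrite psd_supp ?row_sub //.
exact/Fpos/psd_ketbra.
Qed.

Lemma invariantP (X : 'M[C]_n) :
  invariant_space E X <->
  forall v : 'rV_n, (v <= X)%MS -> (E (ketbra v) <= X)%MS.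
Proof.
split=> [EX v vX|EX]; last by apply: channel_image_sub => // v _; exact: EX.
have [->|v0] := eqVneq v 0.
  by rewrite /ketbra mulmx0 linear0 sub0mx.
have [a [u [a0 pu ev]]] := normalize_pure v0.
have uX : (u <= X)%MS by rewrite -(eqmx_scale _ a0) -ev.
rewrite ev ketbraZ linearZ scalemx_sub //.
exact: submx_trans (sub_channel_image Epos pu uX) EX.
Qed.

Lemma eq_invariant (X Y : 'M[C]_n) :
  (X :=: Y)%MS -> invariant_space E X -> invariant_space E Y.
Proof.
by move=> XY /invariantP EX; apply/invariantP => v; rewrite -!XY; exact: EX.
Qed.

Lemma invariant_cap (X Y : 'M[C]_n) :
  invariant_space E X -> invariant_space E Y -> invariant_space E (X :&: Y)%MS.
Proof.
move=> /invariantP EX /invariantP EY; apply/invariantP => v.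
by rewrite !sub_capmx => /andP[/EX-> /EY].
Qed.

Definition minimal_invariant (X : 'M[C]_n) : Prop :=
  [/\ X != 0, invariant_space E X
    & forall Y : 'M[C]_n, Y != 0 -> (Y <= X)%MS -> invariant_space E Y ->
        (X <= Y)%MS].

(** Descent on the rank: a [T] that is not minimal is replaced by a strictly smaller nonzero
    invariant subspace. *)
Lemma minimal_invariant_exists (T : 'M[C]_n) :
  T != 0 -> invariant_space E T ->
  exists2 X : 'M[C]_n, minimal_invariant X & (X <= T)%MS.
Proof.
have [k] := ubnP (\rank T); elim: k T => // k IH T rT T0 ET.
have [[Y [Y0 YT EY TY]]|noY] := pselect (exists Y : 'M[C]_n,
    [/\ Y != 0, (Y <= T)%MS, invariant_space E Y & ~~ (T <= Y)%MS]).
  have [|X mX XY] := IH Y _ Y0 EY.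
    by apply: leq_trans (ltnSE rT); apply: rank_ltmx; rewrite ltmxE YT.
  by exists X => //; exact: submx_trans XY YT.
exists T => //; split=> // Y Y0 YT EY.
by apply: contraT => TY; case: noY; exists Y.
Qed.

(** * Restricted channels, reachability and BSCCs *)

Lemma positive_restriction (X : 'M[C]_n) : positive (channel_restriction E X).
Proof.
move=> A /Epos pA; rewrite /channel_restriction.
by rewrite -{2}(proj_ortho_adj X); exact: psd_conj.
Qed.

(** [E A] is Hermitian, so the projector is absorbed on the left as well as on the right. *)
Lemma channel_restriction_id (X A : 'M[C]_n) :
  psd A -> (E A <= X)%MS -> channel_restriction E X A = E A.
Proof.
move=> /Epos/psd_herm hEA EX; rewrite /channel_restriction.
have -> : proj_ortho X *m E A = E A.
  rewrite -[LHS]trmxCK adjmxM proj_ortho_adj [X in X *m _]hEA.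
  by rewrite proj_ortho_id.
exact: proj_ortho_id.
Qed.

Lemma density_ketbra (v : 'rV[C]_n) : pure v -> density (ketbra v).
Proof. by split; [exact: psd_ketbra|rewrite mxtrace_ketbra]. Qed.

Lemma supp_ketbra (v : 'rV[C]_n) : (supp (ketbra v) :=: v)%MS.
Proof.
apply: eqmx_trans (psd_supp (psd_ketbra v)) _.
by apply/eqmxP/andP; split; [rewrite ketbra_sub|rewrite -ketbra_sub].
Qed.

Lemma sub_reach (K : 'M[C]_n) F (v w : 'rV[C]_n) s :
  pure w -> chain_path K F (ketbra v) s -> last (ketbra v) s = ketbra w ->
  (w <= reach K F v)%MS.
Proof.
move=> pw vs sw; rewrite /reach; set S := (X in spanmx X).
by apply: (proj1 (spanmxP S)); split=> //; exists s.
Qed.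

Lemma reach_refl (K : 'M[C]_n) F (v : 'rV[C]_n) :
  pure v -> (v <= K)%MS -> (v <= reach K F v)%MS.
Proof.
move=> pv vK; apply: (@sub_reach _ _ _ _ [::]) => //; split=> // A.
rewrite inE => /eqP ->; split; first exact: density_ketbra.
by rewrite supp_ketbra.
Qed.

Lemma pure_subspace (X Y : 'M[C]_n) :
  (forall v : 'rV_n, pure v -> (v <= X)%MS -> (v <= Y)%MS) -> (X <= Y)%MS.
Proof.
move=> XY; apply/rV_subP => v vX; have [->|v0] := eqVneq v 0; first exact: sub0mx.
have [a [u [a0 pu ev]]] := normalize_pure v0.
by rewrite ev scalemx_sub // XY // -(eqmx_scale _ a0) -ev.
Qed.

(** A path ending in [w] can be prolonged to any pure state in the row space of [E (ketbra w)],
    since inside the invariant [X] the restricted channel acts as [E]. *)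
Lemma reach_invariant (X : 'M[C]_n) (v : 'rV[C]_n) :
  invariant_space E X -> (v <= X)%MS -> pure v ->
  invariant_space E (reach X (channel_restriction E X) v).
Proof.
move=> /invariantP EX vX pv; set F := channel_restriction E X.
set V := reach _ _ _; apply/invariantP => w wV; apply/positive_sub.
(* The vectors sent into [V] form a kernel, so it is enough to treat the endpoints of paths, which
   span [V]. *)
suff VK : (V <= kermx (dualmx (1%:M - proj_ortho V)))%MS.
  exact/sub_kermxP/(submx_trans wV).
rewrite {1}/V /reach; set S := (X in spanmx X).
apply: (proj2 (spanmxP S)) => {w wV} w [pw [s [ds ps] sw]].
apply/sub_kermxP/positive_sub/pure_subspace => u pu uE.
have wX : (w <= X)%MS.
  have [_] := ds (last (ketbra v) s) (mem_last _ _).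
  by rewrite sw supp_ketbra.
have uX : (u <= X)%MS := submx_trans uE (EX w wX).
apply: (@sub_reach _ _ _ _ (rcons s (ketbra u))) => //; last by rewrite last_rcons.
split.
  move=> A; rewrite -rcons_cons mem_rcons inE => /orP[/eqP ->|/ds //].
  by split; [exact: density_ketbra|rewrite supp_ketbra].
rewrite rcons_path ps sw /= supp_ketbra (submx_trans uE) //.
rewrite -(channel_restriction_id (psd_ketbra w) (EX w wX)).
apply: sub_channel_image => //; first exact: positive_restriction.
by rewrite supp_ketbra.
Qed.

(** Induction along the path: states supported in [X] are sent into [X], where projecting onto the
    larger [Y] changes nothing. *)
Lemma reach_sub_invariant (X Y : 'M[C]_n) (v : 'rV[C]_n) :
  invariant_space E X -> (X <= Y)%MS -> (v <= X)%MS ->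
  (reach Y (channel_restriction E Y) v <= X)%MS.
Proof.
move=> /invariantP EX XY vX; rewrite /reach; set S := (X in spanmx X).
apply: (proj2 (spanmxP S)) => w [pw [s [_ ps] sw]].
rewrite -supp_ketbra -sw; have : (supp (ketbra v) <= X)%MS by rewrite supp_ketbra.
elim: s (ketbra v) ps {sw} => //= B s IH A /andP[AB ps] AX.
apply: IH ps _; apply: submx_trans AB _.
apply: channel_image_sub; first exact: positive_restriction.
move=> u _ uA; have EuX := EX u (submx_trans uA AX).
by rewrite channel_restriction_id ?(submx_trans EuX) //; exact: psd_ketbra.
Qed.

Lemma minimal_invariant_BSCC (X : 'M[C]_n) : minimal_invariant X -> BSCC E X.
Proof.
move=> [X0 EX minX]; split=> //; split.
  have XR (u v : 'rV[C]_n) : pure v -> (u <= X)%MS -> (v <= X)%MS ->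
      (u <= reach X (channel_restriction E X) v)%MS.
    move=> pv uX vX; apply: submx_trans uX (minX _ _ _ _).
    - apply/negP => /eqP R0; have := reach_refl (channel_restriction E X) pv vX.
      rewrite R0 submx0 => /eqP v0; move: pv; rewrite v0 /pure linear0l.
      by move/esym/eqP; rewrite oner_eq0.
    - exact: reach_sub_invariant.
    - exact: reach_invariant.
  by move=> u v pu pv uX vX; split; apply: XR.
(* Maximality: all of [Y] is reachable from any unit vector of [X], yet paths starting in the
   invariant [X] never leave it. *)
move=> Y sY XY; have /rowV0Pn[x xX x0] := X0.
have [a [u [a0 pu ex]]] := normalize_pure x0.
have uX : (u <= X)%MS by rewrite -(eqmx_scale _ a0) -ex.
apply: pure_subspace => v pv vY.
have [vR _] := sY _ _ pv pu vY (submx_trans uX XY).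
exact: submx_trans vR (reach_sub_invariant EX XY uX).
Qed.

End PositiveMap.

(** * Splitting the support of a stationary operator *)

Section Decomposition.
Variables (C : numClosedFieldType) (n : nat).
Variable E : {linear 'M[C]_n -> 'M[C]_n}.
Hypothesis Epos : positive E.
Hypothesis Etp : trace_preserving E.

Variable sigma : 'M[C]_n.
Hypothesis psd_sigma : psd sigma.
Hypothesis E_sigma : E sigma = sigma.

(** By stationarity [sigma] has trace 0 against the dual image of the projector off its support;
    positivity makes the product zero, which is the criterion of [positive_sub] on all of
    [sigma]. *)
Lemma fixed_invariant : invariant_space E sigma.
Proof.
apply/invariantP => // v vS; apply/positive_sub => //.
have pM := psd_dualmx Epos (psd_proj_ortho_compl sigma).
suff sM : sigma *m dualmx E (1%:M - proj_ortho sigma) = 0.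
  by have /submxP[D ->] := vS; rewrite -mulmxA sM mulmx0.
apply: psd_mxtrace_eq0 => //.
by rewrite mxtrace_dualmx E_sigma mulmxBr mulmx1 proj_ortho_id // subrr mxtrace0.
Qed.

(* With P the projector on X and M its dual image, invariance gives M = P + N
   with N positive; N has zero expectation in the stationary state sigma, hence
   vanishes on its support. *)
Lemma invariant_ocomp (X : 'M[C]_n) :
  invariant_space E X -> (X <= sigma)%MS ->
  invariant_space E (sigma :&: ocomp X)%MS.
Proof.
move=> /(invariantP Epos) EX Xs.
set P := proj_ortho X; pose M := dualmx E P; pose M' := dualmx E (1%:M - P).
have pP : psd P := psd_proj_ortho X.
(* Trace preservation means that the dual map is unital. *)
have dual1 : M + M' = 1%:M.
  apply/matrixP => i j; rewrite !mxE -mxtraceD -mulmxDr addrCA subrr addr0 mulmx1.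
  rewrite Etp /mxtrace (bigD1 j) //= big1 => [|k kj]; rewrite !mxE ?eqxx ?addr0 //.
    by rewrite eq_sym.
  by rewrite (negPf kj).
have PM' : P *m M' = 0.
  apply/row_matrixP => i; rewrite row0 row_mul.
  by apply/positive_sub/EX => //; rewrite (submx_trans (row_sub _ _)) ?proj_orthoE.
have PM : P *m M = P by rewrite -[LHS]addr0 -PM' -mulmxDr dual1 mulmx1.
have hP : P^t* = P := proj_ortho_adj X.
have hM : M^t* = M := psd_herm (psd_dualmx Epos pP).
have MP : M *m P = P by rewrite -hP -{1}hM -adjmxM PM.
have PP : P *m P = P := proj_ortho_proj X.
(* As a compression of [M], [N] is visibly positive; it equals [M - P] because [M] acts as the
   identity on [X]. *)
pose N := (1%:M - P) *m M *m (1%:M - P)^t*.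
have pN : psd N by apply/psd_conj/psd_dualmx.
have eN : N = M - P.
  rewrite /N adjmxB adjmx1 hP mulmxBl mul1mx PM mulmxBr mulmx1 mulmxBl MP PP.
  by rewrite subrr subr0.
have sN : sigma *m N = 0.
  apply: psd_mxtrace_eq0 => //.
  by rewrite eN mulmxBr linearB /= mxtrace_dualmx E_sigma subrr.
have EXo : forall v : 'rV_n, (v <= sigma)%MS -> (v <= ocomp X)%MS ->
    (E (ketbra v) <= ocomp X)%MS.
  move=> v /submxP[D ev] /ocompP vX; apply/positive_sub_ocomp => //.
  by rewrite -/P -/M -[M](subrK P) -eN mulmxDr vX addr0 ev -mulmxA sN mulmx0.
apply/invariantP => // v; rewrite !sub_capmx => /andP[vs vX].
by rewrite EXo // andbT; apply: (proj1 (invariantP Epos sigma)); first exact: fixed_invariant.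
Qed.

Lemma ocomp_adds (X T : 'M[C]_n) : (X <= T)%MS ->
  (X + (T :&: ocomp X) :=: T)%MS.
Proof.
move=> XT; apply/eqmxP; rewrite addsmx_sub XT capmxSl /=.
rewrite -[X in (X <= _)%MS](subrK (T *m proj_ortho X)) addmx_sub //; last first.
  by rewrite (submx_trans (proj_ortho_sub _ _)) ?addsmxSl.
rewrite (submx_trans _ (addsmxSr _ _)) // sub_capmx; apply/andP; split.
  rewrite addmx_sub ?eqmx_opp //.
  exact: submx_trans (proj_ortho_sub _ _) XT.
by rewrite -[X in X - _]mulmx1 -mulmxBr submxMl.
Qed.

Lemma invariant_decomposition (T : 'M[C]_n) :
  invariant_space E T -> (T <= sigma)%MS ->
  exists m (B : 'I_m -> 'M[C]_n),
    [/\ forall i, minimal_invariant E (B i),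
        forall i j, i != j -> orthogonal_spaces (B i) (B j)
      & (\sum_(i < m) B i :=: T)%MS].
Proof.
have [k] := ubnP (\rank T); elim: k T => // k IH T rT ET Ts.
have [T0|T0] := eqVneq T 0.
  exists 0, (fun _ => 0); split=> [[]|[]|] //.
  by rewrite big_ord0 T0.
have [X mX XT] := minimal_invariant_exists T0 ET.
have [X0 EX _] := mX; set T' := (T :&: ocomp X)%MS.
have Xs := submx_trans XT Ts.
(* Since [T <= sigma], [T'] is the intersection of [T] with the invariant space
   [sigma :&: ocomp X]. *)
have ET' : invariant_space E T'.
  apply: (eq_invariant Epos) (invariant_cap Epos ET (invariant_ocomp EX Xs)).
  by rewrite capmxA; apply: cap_eqmx (eqmx_refl _); exact/capmx_idPl.
have T'T : (T' < T)%MS.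
  rewrite ltmxE capmxSl; apply: contra X0 => TT'.
  have := submx_trans XT (submx_trans TT' (capmxSr _ _)) => /ocompP.
  by rewrite proj_ortho_id // => ->.
have [|m [B [mB oB sB]]] := IH T' _ ET' (submx_trans (capmxSl _ _) Ts).
  exact: leq_trans (rank_ltmx T'T) (ltnSE rT).
have oX j : orthogonal_spaces X (B j).
  apply: orthogonal_spacesS (submx_refl _) _ (@orthogonal_ocomp _ _ X).
  apply: submx_trans (capmxSr T _); rewrite -/T' -sB.
  exact: (sumsmx_sup j).
(* Index 0 carries [X]; the shifted indices carry the blocks of [T']. *)
exists m.+1, (fun i : 'I_m.+1 => oapp B X (unlift ord0 i)); split.
- by move=> i; case: unliftP => [i' _|_] /=; [exact: mB|].
- move=> i j; case: unliftP => [i' ->|->]; case: unliftP => [j' ->|->] /=.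
  + by move=> ij; apply: oB; apply: contra ij => /eqP ->.
  + by move=> _; exact: orthogonal_spaces_sym.
  + by move=> _; exact: oX.
  + by [].
rewrite big_ord_recl unlift_none /=.
under eq_bigr do rewrite liftK /=.
exact: eqmx_trans (adds_eqmx (eqmx_refl _) sB) (ocomp_adds XT).
Qed.

End Decomposition.

(** A vector common to one block and the sum of the others is orthogonal to itself. *)
Lemma orthogonal_mxdirect (C : numClosedFieldType) n m (B : 'I_m -> 'M[C]_n) :
  (forall i j, i != j -> orthogonal_spaces (B i) (B j)) ->
  mxdirect (\sum_(i < m) B i)%MS.
Proof.
move=> oB; apply/mxdirect_sumsP => i _; apply/eqP/rowV0P => v.
rewrite sub_capmx => /andP[vi /sub_sumsmxP[u vu]].
apply/eqP; rewrite -(dnorm_eq0 (@dotmx C n)) {2}vu; apply/eqP.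
rewrite linear_sumr big1 // => j ji; apply: (oB i j); rewrite 1?eq_sym //.
exact: submxMl.
Qed.

(** * Polarisation, entry bounds and the archimedean property *)

Section KetbraSpan.
Variable C : numClosedFieldType.

Lemma adj_mul_ketbra n (v w : 'rV[C]_n) :
  2%:R *: (v^t* *m w) = ketbra (v + w) - ketbra v - ketbra w
    - 'i *: (ketbra (v + 'i *: w) - ketbra v - ketbra w).
Proof.
apply/matrixP => i j; rewrite !mxE !big_ord1 !mxE !rmorphD !rmorphM /= conjCi.
ring: (@sqrCi C).
Qed.

(** An entry is an inner product of two columns of [B]; bounding [x * y] by the sum of squares
    leaves two diagonal entries, each at most the trace. The factor 2 also covers [i = j]. *)
Lemma psd_entry_le n (A : 'M[C]_n) i j :
  psd A -> `|A i j| <= 2%:R * \tr A.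
Proof.
move=> /psd_factor[B ->].
have e k l : (B^t* *m B) k l = \sum_m (B m k)^* * B m l.
  by rewrite mxE; apply: eq_bigr => m _; rewrite !mxE.
have diag_ge0 k : 0 <= (B^t* *m B) k k.
  by rewrite e; apply: sumr_ge0 => m _; rewrite mulrC mul_conjC_ge0.
have diag_le k : (B^t* *m B) k k <= \tr (B^t* *m B).
  by rewrite /mxtrace (bigD1 k) //= lerDl sumr_ge0.
apply: le_trans (_ : (B^t* *m B) i i + (B^t* *m B) j j <= _); last first.
  by rewrite mulr_natl mulr2n lerD.
rewrite !e -big_split /=; apply: le_trans (ler_norm_sum _ _ _) _.
apply: ler_sum => m _; rewrite normrM norm_conjC.
rewrite ![(B m _)^* * _]mulrC -!normCK.
move: (normr_ge0 (B m i)) (normr_ge0 (B m j)).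
move: `|B m i| `|B m j| => x y x0 y0.
have [xy|yx] := real_leP (ger0_real x0) (ger0_real y0).
  by rewrite (le_trans (ler_wpM2r y0 xy)) // -expr2 lerDr exprn_ge0.
by rewrite (le_trans (ler_wpM2l x0 (ltW yx))) // -expr2 lerDl exprn_ge0.
Qed.

End KetbraSpan.

Section Archimedean.
Variable R : realType.

(** This stands in for limit arguments: a quantity of order 1/N for all N is zero. As [0 <= x] makes
    [x] real, it reduces to real parts. *)
Lemma cplx_archimedean (x K : cplx R) :
  0 <= x -> (forall N : nat, x *+ N.+1 <= K) -> x = 0.
Proof.
case: x => a b; rewrite lecE /= => /andP[/eqP -> a0] xK.
have {}xK N : a *+ N.+1 <= complex.Re K.
  have := xK N.
  by rewrite -[(a +i* 0)%C]/(a%:C)%C -rmorphMn lecE => /andP[].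
move: a0; rewrite le_eqVlt => /orP[/eqP <- //|a0].
have := xK (Num.truncn (complex.Re K / a)).
rewrite -mulr_natl -ler_pdivlMr // => aK.
by have := lt_le_trans (truncnS_gt _) aK; rewrite ltxx.
Qed.

End Archimedean.

(** * The mean ergodic theorem *)

Section MeanErgodic.
Variables (R : realType) (n : nat).
Variable E : {linear 'M[cplx R]_n.+1 -> 'M[cplx R]_n.+1}.
Hypothesis Epos : positive E.
Hypothesis Etp : trace_preserving E.

Implicit Types A B D : 'M[cplx R]_n.+1.

Lemma iter_linearD k A B : iter k E (A + B) = iter k E A + iter k E B.
Proof. by elim: k => //= k ->; rewrite linearD. Qed.

Lemma iter_linearZ k a A : iter k E (a *: A) = a *: iter k E A.
Proof. by elim: k => //= k ->; rewrite linearZ. Qed.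

Definition bounded_orbit A :=
  exists K : cplx R, forall k i j, `|iter k E A i j| <= K.

Lemma bounded_orbitD A B :
  bounded_orbit A -> bounded_orbit B -> bounded_orbit (A + B).
Proof.
move=> [K AK] [L BL]; exists (K + L) => k i j.
by rewrite iter_linearD mxE (le_trans (ler_normD _ _)) ?lerD.
Qed.

Lemma bounded_orbitZ a A : bounded_orbit A -> bounded_orbit (a *: A).
Proof.
move=> [K AK]; exists (`|a| * K) => k i j.
by rewrite iter_linearZ mxE normrM ler_wpM2l.
Qed.

Lemma bounded_orbit_psd A : psd A -> bounded_orbit A.
Proof.
move=> pA; exists (2%:R * \tr A) => k i j.
have [pkA <-] : psd (iter k E A) /\ \tr (iter k E A) = \tr A.
  elim: k => [|k [pk tk]]; first by split; [exact: pA|].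
  by rewrite iterS; split; [exact: Epos|rewrite Etp].
exact: psd_entry_le.
Qed.

(** Orbits of positive operators keep their trace, which bounds the entries; by polarisation the
    operators [ketbra v] span all matrices. *)
Lemma power_bounded A : bounded_orbit A.
Proof.
have kb v : bounded_orbit (ketbra v) by apply/bounded_orbit_psd/psd_ketbra.
have bN B : bounded_orbit B -> bounded_orbit (- B).
  by rewrite -scaleN1r; exact: bounded_orbitZ.
have vw (v w : 'rV_n.+1) : bounded_orbit (v^t* *m w).
  rewrite -[_ *m _]scale1r -(@mulVf _ 2%:R) ?pnatr_eq0 // -scalerA adj_mul_ketbra.
  apply: bounded_orbitZ; apply: bounded_orbitD.
    by do 2!(apply: bounded_orbitD; last exact: bN).
  by apply/bN/bounded_orbitZ; do 2!(apply: bounded_orbitD; last exact: bN).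
rewrite [A]matrix_sum_delta.
have b0 : bounded_orbit 0 by rewrite -(scale0r (ketbra 0)); exact: bounded_orbitZ.
apply: (big_ind bounded_orbit) => // [|i _]; first exact: bounded_orbitD.
apply: (big_ind bounded_orbit) => // [|j _]; first exact: bounded_orbitD.
apply: bounded_orbitZ; rewrite -(mul_delta_mx (0 : 'I_1)).
by rewrite -[delta_mx i 0]trmxCK trmx_delta map_delta_mx.
Qed.

(** The sequence inside [asymptotic_average]: index [N] averages the [N.+1] iterates from the first
    power on. *)
Definition ergodic_mean A (N : nat) : 'M[cplx R]_n.+1 :=
  (N.+1)%:R^-1 *: \sum_(1 <= k < N.+2) iter k E A.

(** The fixed part is its own mean, and the sum over the coboundary [D - E D] telescopes. *)
Lemma ergodic_mean_split B D N : E B = B ->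
  ergodic_mean (B + (D - E D)) N =
  B + N.+1%:R^-1 *: (E D - iter N.+2 E D).
Proof.
move=> EB; have Bk k : iter k E B = B by elim: k => //= k ->.
rewrite /ergodic_mean; have -> : \sum_(1 <= k < N.+2) iter k E (B + (D - E D)) =
    N.+1%:R *: B + (E D - iter N.+2 E D).
  rewrite (eq_bigr (fun k => B - (iter k.+1 E D - iter k E D))); last first.
    move=> k _; rewrite !iter_linearD Bk -scaleN1r iter_linearZ scaleN1r.
    by rewrite -iterSr /= opprB.
  rewrite sumrB telescope_sumr // opprB sumr_const_nat subSS subn0.
  by rewrite scaler_nat.
by rewrite scalerDr scalerA mulVf ?pnatr_eq0 // scale1r.
Qed.

Lemma ergodic_mean_remainder D : exists K : cplx R, forall N i j,
  `|(N.+1%:R^-1 *: (E D - iter N.+2 E D)) i j| *+ N.+1 <= K.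
Proof.
have [K DK] := power_bounded D; exists (K + K) => N i j.
rewrite mxE normrM ger0_norm ?invr_ge0 // -[leLHS]mulr_natl mulrA divff ?pnatr_eq0 //.
rewrite mul1r !mxE (le_trans (ler_normB _ _)) // lerD //.
exact: (DK 1).
Qed.

(** As a fixed point [D - E D] equals each of its means; as a coboundary it has means of order
    1/N. *)
Lemma fixed_coboundary_eq0 D : E (D - E D) = D - E D -> D - E D = 0.
Proof.
move=> ED; have [K DK] := ergodic_mean_remainder D.
apply/matrixP => i j; rewrite [RHS]mxE; apply/eqP; rewrite -normr_eq0.
apply/eqP/(@cplx_archimedean _ _ K) => // N; apply: le_trans (DK N i j).
have := ergodic_mean_split D N (linear0 E); rewrite add0r [RHS]add0r => <-.
have := ergodic_mean_split 0 N ED; rewrite linear0 subr0 addr0.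
have -> : iter N.+2 E 0 = 0.
  by rewrite -(scale0r (0 : 'M[cplx R]_n.+1)) iter_linearZ !scale0r.
by rewrite subr0 scaler0 addr0 => ->.
Qed.

(** The kernel and the image of [1 - E] meet only in 0, so by rank-nullity they fill the space. *)
Lemma ergodic_split A : exists B D, E B = B /\ A = B + (D - E D).
Proof.
pose L : 'End('M[cplx R]_n.+1) := (\1 - linfun E)%VF.
have LE D : L D = D - E D by rewrite !lfunE /= !lfunE /= lfunE.
have kimg : (lker L :&: limg L)%VS = 0%VS.
  apply/eqP; rewrite -subv0; apply/subvP => B; rewrite memv_cap memv0.
  move=> /andP[]; rewrite memv_ker LE subr_eq0 => /eqP EB /memv_imgP[D _ eB].
  by rewrite eB LE; apply/eqP/fixed_coboundary_eq0; rewrite -LE -eB -EB.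
have full : (lker L + limg L)%VS = fullv.
  apply/eqP; rewrite eqEdim subvf /= dimv_disjoint_sum //.
  by rewrite -(limg_ker_dim L fullv) capfv.
have : A \in (lker L + limg L)%VS by rewrite full memvf.
move=> /memv_addP[B BL [_ /memv_imgP[D _ ->] ->]]; exists B, D; rewrite LE.
by split=> //; apply/esym/eqP; move: BL; rewrite memv_ker LE subr_eq0.
Qed.

End MeanErgodic.

(** * From complete positivity to positivity; sums of positive operators *)

Lemma completely_positive_positive (C : numClosedFieldType) n
    (E : 'M[C]_n -> 'M[C]_n) :
  completely_positive E -> positive E.
Proof.
move=> cpE A pA; pose p (_ : 'I_1) := n.
(* Only one block is taken; its size is a one-term sum, not [n] itself, so the two quadratic forms
   have to be compared. *)
have blk (X : 'M[C]_n) (w : 'rV[C]_n) :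
    dotmx ((\mxrow_(j < 1) w) *m (\mxblock_(i < 1, j < 1) X)) (\mxrow_(j < 1) w) =
    dotmx (w *m X) w.
  rewrite !dotmx_trE.
  have -> : (\mxrow_(j < 1) w)^t* = \mxcol_(j < 1) w^t*.
    by rewrite tr_mxrow; apply/matrixP => k l; rewrite !mxE.
  congr (\tr _); rewrite mul_mxrow_mxblock mul_mxrow_mxcol.
  by rewrite !big_ord1.
have pA1 : psd (\mxblock_(i < 1, j < 1) A).
  move=> u; rewrite -[u](submxrowK (q_ := p)).
  have -> : \mxrow_j submxrow u j = \mxrow_(j < 1) (submxrow (q_ := p) u ord0).
    by apply: eq_mxrow => j; rewrite ord1.
  by rewrite blk; exact: pA.
by move=> u; have := cpE 1 (fun _ _ => A) pA1 (\mxrow_(j < 1) u); rewrite blk.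
Qed.

(** The projector off the row space of the sum has trace 0 against the sum, hence against each
    positive summand. *)
Lemma psd_sub_add (C : numClosedFieldType) n (A B : 'M[C]_n) :
  psd A -> psd B -> (A <= (A + B)%R)%MS.
Proof.
move=> pA pB; set Q := 1%:M - proj_ortho (A + B).
have pQ : psd Q := psd_proj_ortho_compl (A + B).
have : \tr (A *m Q) + \tr (B *m Q) = 0.
  by rewrite -mxtraceD -mulmxDl mulmxBr mulmx1 proj_ortho_id // subrr mxtrace0.
move/eqP; rewrite paddr_eq0 ?psd_mxtrace_ge0 // => /andP[/eqP AQ _].
have /eqP := psd_mxtrace_eq0 pA pQ AQ; rewrite mulmxBr mulmx1 subr_eq0 => /eqP eA.
exact/sub_proj_orthoP/esym.
Qed.

Lemma psd_compl_ketbra (C : numClosedFieldType) n (v : 'rV[C]_n) :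
  pure v -> psd (1%:M - ketbra v).
Proof.
move=> pv; have h : (ketbra v)^t* = ketbra v := psd_herm (psd_ketbra v).
have kk : ketbra v *m ketbra v = ketbra v.
  rewrite /ketbra mulmxA -(mulmxA (v^t*)) [v *m _]mx11_scalar -dotmxE pv.
  by rewrite mulmx1.
have <- : (1%:M - ketbra v)^t* *m (1%:M - ketbra v) = 1%:M - ketbra v.
  by rewrite adjmxB adjmx1 h mulmxBl mul1mx mulmxBr mulmx1 kk subrr subr0.
exact: psd_mul_adj.
Qed.

Lemma sum_ketbra_delta (C : numClosedFieldType) n :
  \sum_(i < n) ketbra (delta_mx 0 i : 'rV[C]_n) = 1%:M.
Proof.
rewrite [RHS]matrix_sum_delta; apply: eq_bigr => i _.
rewrite (bigD1 i) //= big1 => [|j ji]; rewrite mxE ?eqxx ?scale1r ?addr0.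
  by rewrite /ketbra trmx_delta map_delta_mx mul_delta_mx.
by rewrite eq_sym (negPf ji) scale0r.
Qed.

Lemma pure_delta (C : numClosedFieldType) n (i : 'I_n) :
  pure (delta_mx 0 i : 'rV[C]_n).
Proof.
rewrite /pure dotmxE trmx_delta map_delta_mx mul_delta_mx.
by rewrite mxE !eqxx.
Qed.

(** * The limit of the means and its image *)

Section AsymptoticAverage.
Variables (R : realType) (n : nat).
Variable E : {linear 'M[cplx R]_n.+1 -> 'M[cplx R]_n.+1}.
Hypothesis Epos : positive E.
Hypothesis Etp : trace_preserving E.

Implicit Types A B D : 'M[cplx R]_n.+1.

Lemma asymptotic_average_split B D :
  E B = B -> asymptotic_average E (B + (D - E D)) = B.
Proof.
move=> EB; apply: cvg_lim; first exact: norm_hausdorff.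
apply/cvg_ballP => e e0.
have [K DK] := ergodic_mean_remainder Epos Etp D.
(* Otherwise all multiples of [e] stay below [K] and [e] is 0. The order on [cplx R] is partial, so
   negating the comparison needs both sides real. *)
have [N0 N0e] : exists N0, K < e *+ N0.+1.
  apply: contrapT => /forallNP Ke.
  suff e00 : e = 0 by move: e0; rewrite e00 ltxx.
  apply: (@cplx_archimedean _ _ K) (ltW e0) _ => N.
  have KR : K \is Num.real.
    by apply/ger0_real/(le_trans _ (DK 0 ord0 ord0))/mulrn_wge0.
  have eR : e *+ N.+1 \is Num.real by rewrite rpredMn // gtr0_real.
  by rewrite real_leNgt //; apply/negP; exact: Ke.
exists N0 => // N /= N0N.
change (ball B e (ergodic_mean E (B + (D - E D)) N)).
rewrite ergodic_mean_split //; split=> // i j.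
rewrite -ball_normE /ball_ /= [X in _ - X]mxE opprD addrA subrr add0r normrN.
rewrite -(@ltr_pMn2r _ N.+1) // (le_lt_trans (DK N i j)) // (lt_le_trans N0e) //.
by rewrite ler_wpMn2l // ltW.
Qed.

Lemma asymptotic_average_fixed A :
  E (asymptotic_average E A) = asymptotic_average E A.
Proof.
have [B [D [EB ->]]] := ergodic_split Epos Etp A.
by rewrite asymptotic_average_split.
Qed.

(** Additivity is read off the splitting, as the splittings of [A] and [A'] add up. *)
Lemma asymptotic_averageD A A' :
  asymptotic_average E (A + A') = asymptotic_average E A + asymptotic_average E A'.
Proof.
have [B [D [EB ->]]] := ergodic_split Epos Etp A.
have [B' [D' [EB' ->]]] := ergodic_split Epos Etp A'.
rewrite addrACA [X in _ + X]addrACA -opprD -linearD.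
by rewrite !asymptotic_average_split // linearD EB EB'.
Qed.

(** The means are positive, and their quadratic form at [u] differs from that of the limit by [r N],
    of order 1/N. *)
Lemma positive_asymptotic_average : positive (asymptotic_average E).
Proof.
move=> A pA; have [B [D [EB eA]]] := ergodic_split Epos Etp A.
have -> : asymptotic_average E A = B by rewrite eA asymptotic_average_split.
move=> u; rewrite dotmx_trE.
have pc N : psd (ergodic_mean E A N).
  apply: psdZ; first by rewrite invr_ge0.
  apply: (big_ind (@psd _ _)) => [v| |k _].
  - by rewrite mulmx0 linear0l.
  - exact: psdD.
  by elim: k => [|k IH]; [exact: pA|rewrite iterS; exact: Epos].
have [K DK] := ergodic_mean_remainder Epos Etp D.
pose f A := \tr (u *m A *m u^t*).
pose r N := f (N.+1%:R^-1 *: (E D - iter N.+2 E D)).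
(* Expanded entrywise, the form at [u] of a matrix with entries of modulus at most [K] is bounded by
   [K']. *)
pose K' : cplx R := \sum_j \sum_i `|u 0 i| * K * `|u 0 j|.
have rK N : `|r N| *+ N.+1 <= K'.
  rewrite /r /f; move: (_^-1 *: _) (DK N) => X XK.
  rewrite /mxtrace big_ord1 mxE -mulr_natr; set M := N.+1%:R.
  apply: le_trans (ler_wpM2r _ (ler_norm_sum _ _ _)) _; first exact: ler0n.
  rewrite mulr_suml; apply: ler_sum => j _.
  rewrite !mxE normrM norm_conjC mulrAC -mulr_suml ler_wpM2r //.
  apply: le_trans (ler_wpM2r _ (ler_norm_sum _ _ _)) _; first exact: ler0n.
  rewrite mulr_suml; apply: ler_sum => i _.
  by rewrite normrM -mulrA ler_wpM2l // mulr_natr.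
have fc N : f (ergodic_mean E A N) = f B + r N.
  by rewrite eA ergodic_mean_split // /f mulmxDr mulmxDl mxtraceD.
(* A number equal to its modulus is nonnegative; the gap between the two is at most twice the
   modulus of [r N]. *)
rewrite -/(f B); suff <- : `|f B| = f B by [].
apply/eqP; rewrite -subr_eq0 -normr_eq0; apply/eqP.
apply: (@cplx_archimedean _ _ (K' *+ 2)) => // N.
apply: le_trans (lerD (rK N) (rK N)).
rewrite -mulr2n -mulrnA mulnC mulrnA lerMn2r /=.
have fB0 : 0 <= f (ergodic_mean E A N) by have := pc N u; rewrite dotmx_trE.
have -> : f B = f (ergodic_mean E A N) - r N by rewrite fc addrK.
move: (f _) (r N) fB0 => z t z0.
have -> : `|z - t| - (z - t) = (`|z - t| - `|z|) + t.
  by rewrite (ger0_norm z0) opprB addrA addrAC.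
rewrite (le_trans (ler_normD _ _)) // mulr2n lerD //.
by rewrite (le_trans (ler_dist_dist _ _)) // addrAC subrr add0r normrN.
Qed.

(** The identity is [ketbra v] plus a positive operator for every unit [v], which gives one
    inclusion; it is also the sum of the [ketbra] of the standard basis, which gives the other. *)
Lemma asymptotic_average_image :
  (channel_image (asymptotic_average E) 1%:M :=: asymptotic_average E 1%:M)%MS.
Proof.
have Spos := positive_asymptotic_average.
apply/eqmxP/andP; split.
  apply: (channel_image_sub Spos) => v pv _.
  rewrite -[1%:M in X in (_ <= X)%MS](subrK (ketbra v)) addrC asymptotic_averageD.
  by apply: psd_sub_add; apply: Spos; [exact: psd_ketbra|exact: psd_compl_ketbra].
have S0 : asymptotic_average E 0 = 0.
  by apply: (addrI (asymptotic_average E 0)); rewrite -asymptotic_averageD !addr0.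
rewrite -{1}sum_ketbra_delta (big_morph _ asymptotic_averageD S0).
apply: summx_sub => i _; apply: (sub_channel_image Spos); last exact: submx1.
exact: pure_delta.
Qed.

End AsymptoticAverage.

Theorem theorem5 (R : realType) (n : nat)
    (E : {linear 'M[cplx R]_n.+1 -> 'M[cplx R]_n.+1}) :
  quantum_markov_chain E ->
  exists (m : nat) (B : 'I_m -> 'M[cplx R]_n.+1),
    [/\ forall i, BSCC E (B i),
        forall i j, i != j -> orthogonal_spaces (B i) (B j),
        mxdirect (\sum_(i < m) B i)%MS
      & (\sum_(i < m) B i :=: channel_image (asymptotic_average E) 1%:M)%MS].
Proof.
move=> [/completely_positive_positive Epos Etp].
have p1 : psd (1%:M : 'M[cplx R]_n.+1).
  by rewrite -[1%:M]mul1mx -{1}adjmx1; exact: psd_mul_adj.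
have psigma := positive_asymptotic_average Epos Etp p1.
have Esigma := asymptotic_average_fixed Epos Etp 1%:M.
(* The stationary operator is the average of the identity, and its whole support is decomposed. *)
have [m [B [mB oB sB]]] := invariant_decomposition Epos Etp psigma Esigma
  (fixed_invariant Epos psigma Esigma) (submx_refl _).
exists m, B; split=> //.
- by move=> i; exact: minimal_invariant_BSCC.
- exact: orthogonal_mxdirect.
exact: eqmx_trans sB (eqmx_sym (asymptotic_average_image Epos Etp)).
Qed.
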